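(* Let $R$ be a domain containing $\mathbb{Q}$. The conjugacy classes of $\mathrm{BAs}_2(R)$ in $\mathrm{BAs}_2(R)$ are parametrized by pairs $(\bar f_1,f_2)$ (the pair corresponding to the class of $(x_1+f_1,x_2+f_2)$ with $f_1$ a lift of $\bar f_1$), where either (1) $f_2=0$ and $\bar f_1=a_nx_2^n+a_{n-1}x_2^{n-1}+\cdots+a_0\in R[x_2]$, where $a_{n-1}$ is picked as a unique representative in $R/a_nR$; or (2) $f_2\in R\setminus\{0\}$ and $\bar f_1=\bar a_nx_2^n+\bar a_{n-1}x_2^{n-1}+\cdots+\bar a_0\in (R/(f_2))[x_2]$, where $\bar a_{n-1}$ is a uniquely picked representative from $(R/(f_2))/(\bar a_n)$. In particular, if $R=k$ is a field, then the classes are those of (1) $(x_1+f(x_2),x_2)$ with $f(x_2)=f_nx_2^n+f_{n-2}x_2^{n-2}+\cdots+f_0\in k[x_2]$, $f_n\neq 0$ (i.e. the next-to-highest term has coefficient zero); (2) $(x_1,x_2+\lambda)$, $\lambda\in k$.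
   Context: $\mathrm{BAs}_2(R)$ is the group (under composition) of strictly triangular polynomial maps $(x_1+f_1,x_2+f_2)$ with $f_1\in R[x_2]$ and $f_2\in R$. Two elements $F,G\in\mathrm{BAs}_2(R)$ are conjugate in $\mathrm{BAs}_2(R)$ if $G=HFH^{-1}$ for some $H\in\mathrm{BAs}_2(R)$. ''Picked as a unique representative'' means that a system of representatives for the indicated quotient is fixed once and for all, and the coefficient is required to lie in that system. The coefficient of index $n$ is the leading coefficient.
   Formalization: In case (2) distinct pairs can give the same class (R=Q[t], f_2=t^2: tx_2^3+x_2 and tx_2^3+x_2-t), so the pair is shown unique only if its leading coefficient is a non-zero-divisor in R/(f_2); in general only f_2, n, the leading and next coefficients are determined. *)

(* Defs.v *)
From HB Require Import structures.
From mathcomp Require Import all_boot all_algebra.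
From mathcomp Require Import generic_quotient ring_quotient.
From mathcomp Require Import boolp finmap mpoly.

Set Implicit Arguments.
Unset Strict Implicit.
Unset Printing Implicit Defensive.

Import GRing.Theory.
Local Open Scope ring_scope.
Local Open Scope quotient_scope.

(* The quotient ring A / aA.  The ideal quotients of ring_quotient are only
   rings for proper ideals.  Here a may be a unit, so A / aA may be the zero
   ring, and the ring structure is put on the quotient of the additive group
   instead.  Membership in aA is made boolean by classical logic. *)
Section PrincipalQuotient.
Variables (A : comPzRingType) (a : A).

Definition pideal : {pred A} := fun x => `[< exists c, x = c * a >].

Fact pideal_zmod_closed : zmod_closed pideal.
Proof.
split; first by apply/asboolP; exists 0; rewrite mul0r.
move=> x y /asboolP[c ->] /asboolP[d ->].
by apply/asboolP; exists (c - d); rewrite mulrBl.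
Qed.
HB.instance Definition _ := GRing.isZmodClosed.Build A pideal pideal_zmod_closed.

Definition pquot := Quotient.quot pideal.
HB.instance Definition _ := Choice.on pquot.
HB.instance Definition _ := ZmodQuotient.on pquot.

Fact pquot_eqP (x y : A) :
  reflect (exists c, x - y = c * a) (x == y %[mod pquot]).
Proof. by rewrite -Quotient.idealrBE; exact: asboolP. Qed.

Definition pquot_one : pquot := \pi_pquot 1.
Definition pquot_mul := lift_op2 pquot *%R.

Fact pi_pquot_mul (x y : A) :
  pquot_mul (\pi_pquot x) (\pi_pquot y) = \pi_pquot (x * y).
Proof.
unlock pquot_mul; have /pquot_eqP[c Ec] : repr (\pi_pquot x) == x %[mod pquot] by rewrite reprK.
have /pquot_eqP[d Ed] : repr (\pi_pquot y) == y %[mod pquot] by rewrite reprK.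
apply/eqP/pquot_eqP; move: Ec Ed; set x' := repr _; set y' := repr _ => Ec Ed.
exists (x' * d + c * y); rewrite mulrDl -mulrA -Ed -mulrA [y * a]mulrC mulrA -Ec.
by rewrite mulrBr mulrBl addrA subrK.
Qed.

Fact pquot_mulA : associative pquot_mul.
Proof.
elim/quotW=> x; elim/quotW=> y; elim/quotW=> z.
by rewrite !pi_pquot_mul mulrA.
Qed.
Fact pquot_mulC : commutative pquot_mul.
Proof.
by elim/quotW=> x; elim/quotW=> y; rewrite !pi_pquot_mul mulrC.
Qed.
Fact pquot_mul1 : left_id pquot_one pquot_mul.
Proof. by elim/quotW=> x; rewrite pi_pquot_mul mul1r. Qed.
Fact pquot_mulD : left_distributive pquot_mul +%R.
Proof.
elim/quotW=> x; elim/quotW=> y; elim/quotW=> z.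
by rewrite -raddfD !pi_pquot_mul mulrDl raddfD.
Qed.
HB.instance Definition _ := GRing.Zmodule_isComPzRing.Build pquot
  pquot_mulA pquot_mulC pquot_mul1 pquot_mulD.

End PrincipalQuotient.

Section Systems.
Variable A : comPzRingType.

Definition is_system (a : A) (S : A -> Prop) : Prop :=
  forall c : pquot a, exists! s : A, S s /\ \pi_(pquot a) s = c.

(* Polynomials over A are given here by their coefficients c : nat -> A. *)
Definition lead_index (c : nat -> A) (n : nat) : Prop :=
  c n <> 0 /\ forall i, (n < i)%N -> c i = 0.

(* With leading index n, the coefficient of index n - 1 lies in the system
   attached to the leading coefficient.  There is no condition on constants. *)
Definition subleading_in (S : A -> A -> Prop) (c : nat -> A) : Prop :=
  forall n, lead_index c n.+1 -> S (c n.+1) (c n).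

(* All coefficients of c and c' from the one just below the top of c upwards
   are equal; for c of degree at most 1 this means that c = c'. *)
Definition same_top (c c' : nat -> A) : Prop :=
  forall n, (forall i, (n < i)%N -> c i = 0) ->
  forall i, (n <= i.+1)%N -> c i = c' i.

End Systems.

(* (A / aA)[x2], as finitely supported coefficient functions: {poly _} is only
   available over nonzero rings. *)
Definition pquot_poly (A : comPzRingType) (a : A) :=
  {fsfun nat -> pquot a for fun=> 0}.

Definition is_lift (R : comNzRingType) (a : R) (f : {poly R}) (fb : pquot_poly a) :=
  forall i, \pi_(pquot a) f`_i = fb i.

Section Maps.
Variable R : comNzRingType.

(* Polynomial maps in (x1, x2); x1 and x2 are the variables of index 0 and 1. *)
Definition polymap := 2.-tuple {mpoly R[2]}.

Definition pmap_comp (F G : polymap) : polymap :=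
  [tuple comp_mpoly G (tnth F i) | i < 2].
Definition pmap_id : polymap := [tuple 'X_i | i < 2].

Definition x1 : {mpoly R[2]} := 'X_(ord0).
Definition x2 : {mpoly R[2]} := 'X_(ord_max).

Definition tri (f1 : {poly R}) (f2 : R) : polymap :=
  [tuple x1 + (map_poly (@mpolyC 2 R) f1).[x2]; x2 + f2%:MP].

Definition BAs2 (F : polymap) : Prop := exists f1 f2, F = tri f1 f2.

Definition conj_BAs2 (F G : polymap) : Prop :=
  exists H Hinv : polymap,
    [/\ BAs2 H, BAs2 Hinv,
        pmap_comp H Hinv = pmap_id, pmap_comp Hinv H = pmap_id &
        G = pmap_comp (pmap_comp H F) Hinv].

End Maps.

Section Data.
Variable R : comNzRingType.

Inductive datum : Type :=
| Datum1 (f1 : {poly R})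
| Datum2 (f2 : R) (f1b : pquot_poly f2).

Definition admissible (S1 : R -> R -> Prop)
    (S2 : forall f2 : R, pquot f2 -> pquot f2 -> Prop) (d : datum) : Prop :=
  match d with
  | Datum1 f1 => subleading_in S1 (nth 0 f1)
  | Datum2 f2 f1b => f2 <> 0 /\ subleading_in (S2 f2) f1b
  end.

Definition realizes (d : datum) (F : polymap R) : Prop :=
  match d with
  | Datum1 f1 => F = tri f1 0
  | Datum2 f2 f1b => exists2 f1, is_lift f1 f1b & F = tri f1 f2
  end.

Definition in_class (d : datum) (F : polymap R) : Prop :=
  exists2 E, realizes d E & conj_BAs2 E F.

Inductive same_leading_data : datum -> datum -> Prop :=
| SameLeading1 f1 : same_leading_data (Datum1 f1) (Datum1 f1)
| SameLeading2 f2 (f1b g1b : pquot_poly f2) of same_top f1b g1b :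
    same_leading_data (Datum2 f1b) (Datum2 g1b).

(* The leading coefficient of a pair with f2 <> 0 need not be regular, as
   R / (f2) may have zero divisors.  Translations of x2 by an element
   annihilating it may then relate distinct pairs with the same leading data:
   for R = Q[t] and f2 = t^2, the pairs with f1 = t x2^3 + x2 and
   f1 = t x2^3 + x2 - t lie in one class. *)
Definition regular_lead (d : datum) : Prop :=
  match d with
  | Datum1 _ => True
  | Datum2 f2 f1b => forall n, lead_index f1b n -> GRing.lreg (f1b n)
  end.

End Data.

Definition field_normal_form (k : fieldType) (F : polymap k) : Prop :=
  (exists2 f : {poly k},
     f != 0 /\ (forall n, size f = n.+2 -> f`_n = 0) & F = tri f 0) \/
  (exists lam : k, F = tri 0 lam).

(* Main.v *)
From HB Require Import structures.
Require Import Defs.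
From mathcomp Require Import all_boot all_algebra.
From mathcomp Require Import generic_quotient boolp finmap mpoly.

(* Conjugating (x1 + f, x2 + a) by (x1 + h, x2 + b) translates x2 by -b in f and
   adds to f a translate of h(x2 + a) - h(x2).  As the positive integers are
   invertible, these differences form exactly the ideal a R[x2], so the class is
   given by a and by the image of f in (R / aR)[x2] up to translations of x2;
   for a = 0 this is f itself up to translations.  The translation by c leaves
   the leading coefficient l of index n unchanged and adds n l c to the next
   one: that one can be moved to the representative of its class modulo l, and
   afterwards only the c with l c = 0 remain, which fix the two top coefficients
   and reduce to c = 0 when l is regular. *)

Set Implicit Arguments.
Unset Strict Implicit.
Unset Printing Implicit Defensive.

Import GRing.Theory.
Local Open Scope ring_scope.
Local Open Scope quotient_scope.

(** * Translations of one-variable polynomials and their differences *)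

Section Translations.
Variable R : comNzRingType.
Implicit Types (f g h p q : {poly R}) (a c : R).

Definition translate p c : {poly R} := p \Po ('X + c%:P).

Lemma translate0 p : translate p 0 = p.
Proof. by rewrite /translate addr0 comp_polyXr. Qed.

Lemma translateD p c a : translate p (c + a) = translate (translate p c) a.
Proof.
by rewrite /translate -comp_polyA comp_polyD comp_polyX comp_polyC polyCD
     addrA addrAC.
Qed.

Lemma translate_scale a c p : translate (a *: p) c = a *: translate p c.
Proof. exact: comp_polyZ. Qed.

Lemma translate_add p q c : translate (p + q) c = translate p c + translate q c.
Proof. exact: comp_polyD. Qed.

Lemma translateN p c : translate (- p) c = - translate p c.
Proof. exact: raddfN. Qed.

(** The bound [N] is free, so that sums for different polynomials can share a range and contain
    prescribed indices. For [j < i] the term vanishes through ['C(j, i)], whatever the truncated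
    exponent [j - i]. *)
Lemma coef_translate p c i N : (size p <= N)%N ->
  (translate p c)`_i = \sum_(j < N) p`_j * (c ^+ (j - i) *+ 'C(j, i)).
Proof.
move=> leN; have coefX j : (('X + c%:P) ^+ j)`_i = c ^+ (j - i) *+ 'C(j, i).
  rewrite addrC exprDn coef_sum; under eq_bigr => k _.
    rewrite coefMn -polyC_exp coefCM coefXn.
  over.
  have [ltji | leij] := ltnP j i.
    rewrite bin_small // big1 // => k _.
    by rewrite gtn_eqF ?mulr0 ?mul0rn //; apply: leq_trans ltji; apply: ltn_ord.
  rewrite (bigD1 (Ordinal (leij : (i < j.+1)%N))) //= eqxx mulr1 big1 ?addr0 //.
  move=> k; rewrite -val_eqE /= eq_sym => /negbTE ->.
  by rewrite mulr0 mul0rn.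
rewrite coef_comp_poly; under eq_bigr do rewrite coefX.
rewrite (big_ord_widen _ (fun j => p`_j * (c ^+ (j - i) *+ 'C(j, i))) leN).
rewrite big_mkcond; apply: eq_bigr => j _; case: ltnP => // lepj.
by rewrite nth_default ?mul0r.
Qed.

(** Induction in Horner form: for [p * 'X + b%:P] the difference is [(translate p a - p) * 'X + a *:
    translate p a]. *)
Lemma translate_diff a p : exists q, translate p a - p = a *: q.
Proof.
elim/poly_ind: p => [|p b [q Eq]].
  by exists 0; rewrite /translate comp_poly0 subr0 scaler0.
exists (q * 'X + translate p a).
rewrite /translate comp_polyD comp_polyC comp_polyM comp_polyX -/(translate p a).
rewrite scalerDr scalerAl -Eq -mul_polyC mulrBl mulrDr [_ * a%:P]mulrC.
by rewrite opprD addrACA subrr addr0 addrAC.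
Qed.

(* By induction on the size of [q]: subtracting from [q] the difference of a
   monomial of degree [size q], divided by [a], cancels the leading term. *)
Lemma translate_diff_onto a q (natU : forall n, exists u : R, u * n.+1%:R = 1) :
  exists p, translate p a - p = a *: q.
Proof.
elim: (size q) {-2}q (leqnn (size q)) => [|n IHn] {}q.
  rewrite leqn0 size_poly_eq0 => /eqP ->; exists 0.
  by rewrite /translate comp_poly0 subr0 scaler0.
move=> szq; have [u un1] := natU n.
(* [s] is the cofactor of [a] in [('X + a%:P) ^+ n.+1 - 'X^(n.+1)], given by the factorisation of a
   difference of powers. Its [n.+1] summands are monic of degree [n], whence its coefficient [n.+1]
   at index [n]. *)
pose s : {poly R} := \sum_(i < n.+1) ('X + a%:P) ^+ (n - i) * 'X^i.
have leadE (i : 'I_n.+1) :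
    size (('X + a%:P) ^+ (n - i) * 'X^i : {poly R}) = n.+1 /\
    (('X + a%:P) ^+ (n - i) * 'X^i : {poly R})`_n = 1.
  have mon : ('X + a%:P) ^+ (n - i) * 'X^i \is @monic R.
    by rewrite monicMl ?monicXn // -[a]opprK polyCN monic_exp // monicXsubC.
  have sz : size (('X + a%:P) ^+ (n - i) * 'X^i : {poly R}) = n.+1.
    rewrite -[a]opprK polyCN size_monicM ?monic_exp ?monicXsubC ?monic_neq0
      ?monicXn //.
    by rewrite size_exp_XsubC size_polyXn addSn addnS /= subnK // -ltnS.
  by split=> //; move/monicP: mon; rewrite lead_coefE sz.
have szs : (size s <= n.+1)%N.
  apply: (leq_trans (size_sum _ _ _)); apply/bigmax_leqP=> i _.
  by case: (leadE i) => ->.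
have sn : s`_n = n.+1%:R.
  rewrite coef_sum (eq_bigr (fun=> 1)) ?sumr_const ?card_ord // => i _.
  by case: (leadE i).
pose b := q`_n.
have [|p Ep] := IHn (q - (b * u) *: s).
  rewrite -ltnS ltn_neqAle (leq_trans (size_polyD _ _)) ?andbT; last first.
    by rewrite size_polyN geq_max szq (leq_trans (size_scale_leq _ _)).
  apply/negP=> /eqP sz1.
  have: lead_coef (q - (b * u) *: s) = 0.
    by rewrite lead_coefE sz1 /= coefB coefZ sn -mulrA un1 mulr1 subrr.
  by move/eqP; rewrite lead_coef_eq0 => /eqP E0; rewrite E0 size_poly0 in sz1.
exists (p + (b * u) *: 'X^(n.+1)).
have Es : translate 'X^(n.+1) a - 'X^(n.+1) = a *: s.
  by rewrite /translate comp_Xn_poly subrXX /= [_ - _]addrAC subrr add0r mul_polyC.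
rewrite translate_add translate_scale.
by rewrite opprD addrACA Ep -scalerBr Es (scalerA (b * u) a) [b * u * a]mulrC -(scalerA a) -scalerDr subrK.
Qed.

End Translations.

(** * Conjugacy of triangular maps in terms of pairs *)

Section Conjugacy.
Variable R : comNzRingType.
Implicit Types (f g h p q : {poly R}) (a c : R).

Lemma ord2P (i : 'I_2) : i = ord0 \/ i = ord_max.
Proof. by case: i => [[|[|//]] lti]; [left | right]; apply: val_inj. Qed.

(** Reduces composition to arithmetic on pairs: the right map is substituted into the left one, so
    [f] is evaluated at [x2 + c]. *)
Lemma tri_comp f g a c :
  pmap_comp (tri f a) (tri g c) = tri (g + translate f c) (a + c).
Proof.
have E0 : tnth (tri g c) ord0 = x1 R + (map_poly (@mpolyC 2 R) g).[x2 R] by [].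
have E1 : tnth (tri g c) ord_max = x2 R + c%:MP by [].
have X0 : x1 R \mPo tri g c = x1 R + (map_poly (@mpolyC 2 R) g).[x2 R].
  by rewrite -E0 /x1 comp_mpolyXU -tnth_nth.
have X1 : x2 R \mPo tri g c = x2 R + c%:MP.
  by rewrite -E1 /x2 comp_mpolyXU -tnth_nth.
apply: eq_from_tnth => i; rewrite tnth_mktuple.
have [-> | ->] := ord2P i.
- rewrite [tnth (tri f a) _]/(x1 R + (map_poly (@mpolyC 2 R) f).[x2 R]).
  rewrite [RHS]/(x1 R + (map_poly (@mpolyC 2 R) (g + translate f c)).[x2 R]).
  rewrite comp_mpolyD X0 rmorphD /= hornerD -addrA; congr (_ + (_ + _)).
  rewrite -horner_map /= -map_poly_comp X1.
  rewrite (eq_map_poly (g := @mpolyC 2 R)); last by move=> b /=; rewrite comp_mpolyC.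
  rewrite /translate map_comp_poly rmorphD /= map_polyX map_polyC /= horner_comp.
  by rewrite !hornerE.
- rewrite [tnth (tri f a) _]/(x2 R + a%:MP) [RHS]/(x2 R + (a + c)%:MP).
  by rewrite comp_mpolyD X1 comp_mpolyC mpolyCD -!addrA [c%:MP + _]addrC.
Qed.

Lemma pmap_id_tri : pmap_id R = tri 0 0.
Proof.
apply: eq_from_tnth => i; rewrite tnth_mktuple.
have [-> | ->] := ord2P i.
- rewrite [RHS]/(x1 R + (map_poly (@mpolyC 2 R) 0).[x2 R]) map_poly0 horner0; exact/esym/addr0.
- rewrite [RHS]/(x2 R + 0%:MP) mpolyC0; exact/esym/addr0.
Qed.

Lemma tri_inj f g a c : tri f a = tri g c -> f = g /\ a = c.
Proof.
move=> Efg; split; last first.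
  have : x2 R + a%:MP = x2 R + c%:MP := congr1 (fun F => tnth F ord_max) Efg.
  by move/addrI/eqP; rewrite mpolyC_eq => /eqP.
have /addrI : x1 R + (map_poly (@mpolyC 2 R) f).[x2 R]
    = x1 R + (map_poly (@mpolyC 2 R) g).[x2 R] := congr1 (fun F => tnth F ord0) Efg.
(* Sending both variables to ['X] gives a left inverse of the evaluation of polynomials at [x2]. *)
pose rho := mmap (@polyC R) (fun _ : 'I_2 => 'X).
have rhoK p : rho (map_poly (@mpolyC 2 R) p).[x2 R] = p.
  rewrite /rho -horner_map /= -map_poly_comp /x2 mmapX mmap1U.
  rewrite (eq_map_poly (g := @polyC R)); last by move=> b /=; rewrite mmapC.
  by rewrite -/(comp_poly 'X p) comp_polyXr.
by move/(congr1 rho); rewrite !rhoK.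
Qed.

Lemma conj_triP (natU : forall n, exists u : R, u * n.+1%:R = 1) f a G :
  conj_BAs2 (tri f a) G <->
  exists c q, G = tri (translate f c + a *: q) a.
Proof.
split=> [[H [Hinv [[h [b ->]] [u [c ->]]]]] | [c [q ->]]].
  rewrite !tri_comp pmap_id_tri => /tri_inj[Eu Ebc] _ ->.
  have [q Eq] := translate_diff a h.
  (* [c] is the translation part of the inverse, whose first component [u] cancels the translate of
     [h]. *)
  exists c, (translate q c); congr tri; last by rewrite addrAC Ebc add0r.
  have -> : translate h a = h + a *: q by rewrite -Eq addrC subrK.
  by rewrite !translate_add translate_scale (addrCA (translate f c)) (addrA u) Eu add0r.
(* The equation is solved for [q] translated by [- c], because composing with the inverse translates
   by [c] and so restores [q]. *)
have [p Ep] := @translate_diff_onto R a (translate q (- c)) natU.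
exists (tri p (- c)), (tri (- translate p c) c); split.
- by exists p, (- c).
- by exists (- translate p c), c.
- by rewrite tri_comp pmap_id_tri addNr addNr.
- by rewrite tri_comp pmap_id_tri translateN -translateD !addrN translate0 addrN.
rewrite !tri_comp; congr tri; last by rewrite addrAC addNr add0r.
have -> : translate p a = p + a *: translate q (- c) by rewrite -Ep addrC subrK.
rewrite !translate_add translate_scale -translateD addNr translate0.
by rewrite addrCA addKr.
Qed.

End Conjugacy.

(** * The projection to a principal quotient and systems of representatives *)

Section PrincipalQuotientTheory.
Variables (A : comPzRingType) (a : A).

(** A named function, so that the projection carries a ring morphism structure and can serve as
    [phi] in the normal form lemmas. *)
Definition pquot_pi (x : A) : pquot a := \pi_(pquot a) x.

Fact pquot_pi_zmod_morphism : zmod_morphism pquot_pi.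
Proof. by move=> x y; rewrite /pquot_pi raddfB. Qed.
HB.instance Definition _ :=
  GRing.isZmodMorphism.Build A (pquot a) pquot_pi pquot_pi_zmod_morphism.

Fact pquot_pi_monoid_morphism : monoid_morphism pquot_pi.
Proof. by split=> // x y; apply/esym/pi_pquot_mul. Qed.
HB.instance Definition _ :=
  GRing.isMonoidMorphism.Build A (pquot a) pquot_pi pquot_pi_monoid_morphism.

Lemma pquot_piP x y : pquot_pi x = pquot_pi y <-> exists c, x - y = c * a.
Proof. by split=> [/eqP/pquot_eqP | /pquot_eqP/eqP]. Qed.

Lemma pquot_pi_surj (y : pquot a) : exists x, pquot_pi x = y.
Proof. by exists (repr y); rewrite /pquot_pi reprK. Qed.

Lemma is_system_inj (S : A -> Prop) x y :
  is_system a S -> S x -> S y -> (exists c, x - y = c * a) -> x = y.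
Proof.
move=> sysS Sx Sy /pquot_piP Exy; have [s [_ uniq_s]] := sysS (pquot_pi x).
by rewrite -(uniq_s x) // -(uniq_s y).
Qed.

Lemma is_system_ex (S : A -> Prop) x :
  is_system a S -> exists2 s, S s & exists c, s - x = c * a.
Proof.
by move=> sysS; have [s [[Ss /pquot_piP Es] _]] := sysS (pquot_pi x); exists s.
Qed.

End PrincipalQuotientTheory.

Lemma lead_indexP (A : comPzRingType) (c : nat -> A) N :
  (forall i, (N <= i)%N -> c i = 0) ->
  (forall i, c i = 0) \/ exists n, lead_index c n.
Proof.
elim: N => [|N IHN] c0; first by left=> i; apply: c0.
have [cN0 | cN0] := pselect (c N = 0); last by right; exists N.
by apply: IHN => i; rewrite leq_eqVlt => /predU1P[<- | /c0].
Qed.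

Lemma lead_index_uniq (A : comPzRingType) (c : nat -> A) m n :
  lead_index c m -> lead_index c n -> m = n.
Proof.
move=> [cm0 cm] [cn0 cn]; case: (ltngtP m n) => // ltmn.
- by case: cn0; apply: cm.
- by case: cm0; apply: cn.
Qed.

(** * Normal forms under translation, with coefficients read through a morphism [phi] *)

Section NormalForm.
Variables (R : comNzRingType) (A : comPzRingType) (phi : {rmorphism R -> A}).
Implicit Types (f g p q : {poly R}) (c d : R).

Lemma rmorph_coef_translate p c i N : (size p <= N)%N ->
  phi (translate p c)`_i = \sum_(j < N) phi p`_j * (phi c ^+ (j - i) *+ 'C(j, i)).
Proof.
move=> leN; rewrite (coef_translate _ _ leN) rmorph_sum; apply: eq_bigr => j _.
by rewrite rmorphM rmorphMn rmorphXn.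
Qed.

Lemma eq_coef_translate p q c d : (forall i, phi p`_i = phi q`_i) -> phi c = phi d ->
  forall i, phi (translate p c)`_i = phi (translate q d)`_i.
Proof.
move=> Epq Ecd i.
rewrite (rmorph_coef_translate _ _ (leq_maxl (size p) (size q))).
rewrite (rmorph_coef_translate _ _ (leq_maxr (size p) (size q))).
by apply: eq_bigr => j _; rewrite Epq Ecd.
Qed.

Lemma coef_translate_gt p c N : (forall i, (N < i)%N -> phi p`_i = 0) ->
  forall i, (N < i)%N -> phi (translate p c)`_i = 0.
Proof.
move=> p0 i ltNi; rewrite (rmorph_coef_translate _ _ (leqnn _)) big1 // => j _.
have [ltji | leij] := ltnP j i; first by rewrite bin_small ?mulr0n ?mulr0.
by rewrite p0 ?mul0r // (leq_trans ltNi).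
Qed.

Lemma coef_translate_lead p c N : (forall i, (N < i)%N -> phi p`_i = 0) ->
  phi (translate p c)`_N = phi p`_N.
Proof.
(* Enlarging the range by [N.+1] makes [N] a valid index even if [size p <= N]. *)
move=> p0; rewrite (rmorph_coef_translate _ _ (leq_addl N.+1 (size p))).
have ltN : (N < N.+1 + size p)%N by rewrite addSn ltnS leq_addr.
rewrite (bigD1 (Ordinal ltN)) //= subnn binn mulr1 big1 ?addr0 // => j.
rewrite -val_eqE /=; case: ltngtP => // [ltjN | ltNj] _.
- by rewrite bin_small ?mulr0n ?mulr0.
- by rewrite p0 ?mul0r.
Qed.

(** Only the terms [j = n] and [j = n.+1] of the binomial sum survive, the latter with the factor
    ['C(n.+1, n) = n.+1]. *)
Lemma coef_translate_sublead p c n : (forall i, (n.+1 < i)%N -> phi p`_i = 0) ->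
  phi (translate p c)`_n = phi p`_n + phi p`_n.+1 * phi c *+ n.+1.
Proof.
move=> p0; rewrite (rmorph_coef_translate _ _ (leq_addl n.+2 (size p))).
have ltn1 : (n.+1 < n.+2 + size p)%N by rewrite addSn ltnS leq_addr.
rewrite (bigD1 (Ordinal (ltnW ltn1))) //= subnn binn mulr1; congr (_ + _).
rewrite (bigD1 (Ordinal ltn1)) /= -?val_eqE /= ?gtn_eqF //.
rewrite subSnn expr1 binSn mulrnAr big1 ?addr0 // => j.
rewrite -!val_eqE /= => /andP[]; case: ltngtP => // [ltjn | ltnj] _.
- by rewrite bin_small ?mulr0n ?mulr0.
- by rewrite neq_ltn ltnS leqNgt ltnj /= => /p0 ->; rewrite mul0r.
Qed.

Hypothesis natU : forall n, exists u : R, u * n.+1%:R = 1.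
Variable S : A -> A -> Prop.
Hypothesis sysS : forall a, is_system a (S a).

Lemma lead_index_coef f :
  (forall i, phi f`_i = 0) \/ exists n, lead_index (fun i => phi f`_i) n.
Proof.
by apply: (@lead_indexP _ _ (size f)) => i le_i; rewrite nth_default ?rmorph0.
Qed.

Lemma normal_form_exists f : (forall y, exists x, phi x = y) ->
  exists c, subleading_in S (fun i => phi (translate f c)`_i).
Proof.
move=> phi_surj; have [f0 | [[|n] leadn]] := lead_index_coef f.
(* [subleading_in] only constrains leading indices of the form [n.+1], so zero and constant images
   need no translation. *)
- by exists 0 => n; rewrite translate0 => -[]; rewrite f0.
- by exists 0 => n; rewrite translate0 => /(lead_index_uniq leadn).
have [s Ss [e Es]] := is_system_ex (phi f`_n) (@sysS (phi f`_n.+1)).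
have [[u un1] [d Ed]] := (natU n, phi_surj e).
(* The subleading coefficient must move by [e] times the leading one, and a translation by [c] moves
   it by [n.+1] times [phi c] times the leading one; so [c] is a lift of [e] divided by [n.+1]. *)
exists (u * d) => m; have [fn0 fgt] := leadn.
have tlead : lead_index (fun i => phi (translate f (u * d))`_i) n.+1.
  by split; [rewrite coef_translate_lead | apply: coef_translate_gt].
move=> /(lead_index_uniq tlead)[<-]; rewrite coef_translate_lead //.
rewrite coef_translate_sublead //.
suff -> : phi f`_n.+1 * phi (u * d) *+ n.+1 = e * phi f`_n.+1 by rewrite -Es addrC subrK.
rewrite -mulrnAr -rmorphMn -mulrnAl -[u *+ _]mulr_natr un1 mul1r Ed.
exact: mulrC.
Qed.

(** Translation changes the subleading coefficient only by a multiple of the leading one, so two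
    representatives from the same system coincide. The leading coefficient then annihilates
    [phi d *+ n.+1], and regularity forces [phi d = 0]. *)
Lemma normal_form_unique f g d :
    (forall i, phi g`_i = phi (translate f d)`_i) ->
    subleading_in S (fun i => phi f`_i) -> subleading_in S (fun i => phi g`_i) ->
  same_top (fun i => phi f`_i) (fun i => phi g`_i) /\
  ((forall n, lead_index (fun i => phi f`_i) n -> GRing.lreg (phi f`_n)) ->
   forall i, phi f`_i = phi g`_i).
Proof.
move=> Eg Sf Sg.
have fg0 n : (forall i, (n < i)%N -> phi f`_i = 0) ->
    forall i, (n <= i)%N -> phi f`_i = phi g`_i.
  move=> f0 i; rewrite leq_eqVlt Eg => /predU1P[<- | lti].
    by rewrite coef_translate_lead.
  by rewrite f0 // (coef_translate_gt _ f0).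
have [f0 | [[|n] leadn]] := lead_index_coef f.
- have Efg i : phi f`_i = phi g`_i by apply: (fg0 0).
  by split=> // n _ i _; apply: Efg.
- have Efg i : phi f`_i = phi g`_i by case: leadn => _ f0; apply: (fg0 0).
  by split=> // n _ i _; apply: Efg.
have [fn0 fgt] := leadn.
have leadg : lead_index (fun i => phi g`_i) n.+1.
  by split=> [|i lti]; rewrite -(fg0 _ fgt) //; [apply: fgt | apply: ltnW].
have Egn : phi g`_n = phi f`_n + phi f`_n.+1 * phi d *+ n.+1.
  by rewrite Eg coef_translate_sublead.
have Efgn : phi f`_n = phi g`_n.
  apply: is_system_inj (@sysS (phi f`_n.+1)) (Sf n leadn) _ _.
    by rewrite (fg0 _ fgt) //; apply: Sg.
  exists (- (phi d *+ n.+1)); rewrite Egn opprD addrA subrr add0r mulNr.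
  by rewrite mulrnAl [phi d * _]mulrC.
split=> [m fm0 i | reg i].
  (* A bound [m] past which the image of [f] vanishes is at least the leading index [n.+1], so
     [same_top] only asks about indices from [n] on. *)
  have ltnm : (n < m)%N by rewrite ltnNge; apply/negP => lemn; case: fn0; apply: fm0.
  move=> /(leq_trans ltnm); rewrite leq_eqVlt => /predU1P[[<-] // | lti].
  exact: fg0 fgt _ lti.
have phid0 : phi d = 0.
  have [u un1] := natU n.
  rewrite -[phi d]mul1r -(rmorph1 phi) -un1 rmorphM rmorph_nat -mulrA [_ * phi d]mulr_natl.
  suff -> : phi d *+ n.+1 = 0 by rewrite mulr0.
  apply: (reg _ leadn); rewrite mulr0 mulrnAr.
  by apply: (addrI (phi f`_n)); rewrite -Egn addr0 Efgn.
rewrite Eg -{1}[f]translate0; apply: eq_coef_translate => //.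
by rewrite rmorph0 phid0.
Qed.

End NormalForm.

(** * Classes described by lifts of reduced polynomials *)

Section Classes.
Variable R : comNzRingType.
Hypothesis natU : forall n, exists u : R, u * n.+1%:R = 1.
Implicit Types (f g q : {poly R}) (a b : R).

(** Links coefficientwise congruence modulo [a] to the terms [a *: q] of [conj_triP]. *)
Lemma eq_pquot_poly a f g :
  (forall i, pquot_pi a f`_i = pquot_pi a g`_i) <-> exists q, f = g + a *: q.
Proof.
split=> [Efg | [q ->] i]; last first.
  by apply/pquot_piP; exists q`_i; rewrite coefD coefZ addrC addKr mulrC.
have /boolp.choice[c Ec] i : exists x, f`_i - g`_i = x * a by apply/pquot_piP.
(* Choice gives cofactors at all indices; past both sizes the coefficients of [f] and [g] vanish, so
   truncation loses nothing. *)
exists (\poly_(i < maxn (size f) (size g)) c i); apply/polyP=> i.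
rewrite coefD coefZ coef_poly; case: ltnP => [_ | ].
  by rewrite mulrC -Ec addrC subrK.
by rewrite geq_max => /andP[lef leg]; rewrite !nth_default // mulr0 addr0.
Qed.

Lemma is_lift_pquot_poly a f : exists fb : pquot_poly a, is_lift f fb.
Proof.
exists [fsfun i in [fset j | j in iota 0 (size f)]%fset => pquot_pi a f`_i].
move=> i; rewrite fsfunE; case: ifP => //.
rewrite in_fset /= mem_iota add0n /= => /negbT; rewrite -leqNgt => le_i.
by rewrite nth_default // raddf0.
Qed.

Lemma pquot_poly_lift a (fb : pquot_poly a) : exists f, is_lift f fb.
Proof.
(* The largest index of the support bounds the degree. For an empty support the maximum is [0], and
   index [0] merely receives a representative of zero. *)
exists (\poly_(i < (\max_(j <- finsupp fb) j).+1) repr (fb i)) => i.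
rewrite coef_poly ltnS; case: leqP => [_ | lti]; first by rewrite reprK.
rewrite raddf0 fsfun_dflt //; apply/negP => i_supp.
by move: lti; rewrite ltnNge (leq_bigmax_seq (F := id)).
Qed.

(** Both descriptions of [F] are equated and the translation of [g] is undone; this keeps the error
    term a multiple of [a]. *)
Lemma conj_tri_join f g a b F :
  conj_BAs2 (tri f a) F -> conj_BAs2 (tri g b) F ->
  a = b /\ exists d q, g = translate f d + a *: q.
Proof.
move=> /(conj_triP natU)[c [q ->]] /(conj_triP natU)[d [r]] /tri_inj[Efg Eab].
split=> //; subst b; exists (c - d), (translate (q - r) (- d)).
rewrite translateD -translate_scale -translate_add scalerBr addrA Efg addrK.
by rewrite -translateD addrN translate0.
Qed.

Lemma in_class1 f F : in_class (Datum1 f) F <-> conj_BAs2 (tri f 0) F.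
Proof. by split=> [[E -> //] | EF]; exists (tri f 0). Qed.

(** Two lifts differ by a multiple of [a], which conjugacy absorbs, so the class does not depend on
    the lift. *)
Lemma in_class2 a (fb : pquot_poly a) f F : is_lift f fb ->
  in_class (Datum2 fb) F <-> conj_BAs2 (tri f a) F.
Proof.
move=> fL; split=> [[E [g gL ->]] | EF]; last by exists (tri f a); first exists f.
have /eq_pquot_poly[q Eq] i : pquot_pi a g`_i = pquot_pi a f`_i.
  by rewrite [LHS]gL [RHS]fL.
move=> /(conj_triP natU)[c [r ->]]; apply/(conj_triP natU).
exists c, (translate q c + r).
by rewrite Eq translate_add translate_scale scalerDr addrA.
Qed.

Lemma conj_tri_sym f g a b : conj_BAs2 (tri f a) (tri g b) -> conj_BAs2 (tri g b) (tri f a).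
Proof.
(* Reflexivity makes [tri g b] itself a common member for [conj_tri_join]. *)
move=> fg; have gg : conj_BAs2 (tri g b) (tri g b).
  by apply/(conj_triP natU); exists 0, 0; rewrite translate0 scaler0 addr0.
have [Eba [d [q ->]]] := conj_tri_join gg fg.
by rewrite -Eba; apply/(conj_triP natU); exists d, q.
Qed.


End Classes.

(** * Existence and uniqueness of the admissible datum of a class *)

Section Parametrization.
Variable R : idomainType.
Hypothesis natU : forall n, exists u : R, u * n.+1%:R = 1.
Variables (S1 : R -> R -> Prop) (S2 : forall a : R, pquot a -> pquot a -> Prop).
Hypothesis sysS1 : forall a, is_system a (S1 a).
Hypothesis sysS2 : forall a (b : pquot a), is_system b (S2 b).

Lemma in_class_conj d : admissible S1 S2 d ->
  exists2 E : polymap R, BAs2 E & forall F : polymap R, in_class d F <-> conj_BAs2 E F.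
Proof.
case: d => [f | a fb] _.
  by exists (tri f 0); [exists f, 0 | move=> F; apply: in_class1].
have [f fL] := pquot_poly_lift fb.
by exists (tri f a); [exists f, a | move=> F; apply: in_class2].
Qed.

Lemma in_class_exists F : BAs2 F ->
  exists2 d : datum R, admissible S1 S2 d & in_class d F.
Proof.
move=> [f [a ->]]; have [-> | a0] := pselect (a = 0).
  (* With [idfun] as the morphism, the normal form is taken in [R[x2]] itself. *)
  have [|c nf] := @normal_form_exists _ _ idfun natU _ sysS1 f; first by move=> y; exists y.
  exists (Datum1 (translate f c)) => //.
  apply/in_class1/(conj_tri_sym natU)/(conj_triP natU).
  by exists c, 0; rewrite scaler0 addr0.
have [c nf] := normal_form_exists natU (@sysS2 a) f (@pquot_pi_surj _ a).
have [fb fL] := is_lift_pquot_poly a (translate f c).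
exists (Datum2 fb).
  split=> //; suff -> : (fb : nat -> pquot a) = fun i => pquot_pi a (translate f c)`_i by [].
  by apply/funext => i; rewrite -fL.
apply/(in_class2 natU _ fL)/(conj_tri_sym natU)/(conj_triP natU).
by exists c, 0; rewrite scaler0 addr0.
Qed.

Lemma in_class_unique d d' F : admissible S1 S2 d -> admissible S1 S2 d' ->
  in_class d F -> in_class d' F ->
  same_leading_data d d' /\ (regular_lead d -> d = d').
Proof.
case: d d' => [f | a fb] [g | b gb] /=.
- move=> nf ng /in_class1 Ff /in_class1 Fg.
  have [_ [d [q]]] := conj_tri_join natU Ff Fg; rewrite scale0r addr0 => Eg.
  have Egi i : idfun g`_i = idfun (translate f d)`_i by rewrite Eg.
  have [_ eq] := normal_form_unique natU sysS1 Egi nf ng.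
  have -> : g = f.
    (* In a domain the nonzero leading coefficient is regular, so the full equality is available. *)
    by apply/esym/polyP; apply: eq => n [fn0 _]; apply/mulfI/eqP.
  by split=> //; constructor.
(* The second component is constant on classes, so both mixed cases contradict [f2 <> 0]. *)
- move=> _ [b0 _] /in_class1 Ff; have [g gL] := pquot_poly_lift gb.
  by move=> /(in_class2 natU _ gL) /(conj_tri_join natU Ff)[/esym].
- move=> [a0 _] _; have [f fL] := pquot_poly_lift fb.
  by move=> /(in_class2 natU _ fL) Ff /in_class1 /(conj_tri_join natU Ff)[].
move=> [_ nf] [_ ng].
have [f fL] := pquot_poly_lift fb; have [g gL] := pquot_poly_lift gb.
move=> /(in_class2 natU _ fL) Ff /(in_class2 natU _ gL) /(conj_tri_join natU Ff)[Eab].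
(* Eliminating the equality moves [gb] from the quotient by [b] to the quotient by [a], where it can
   be compared with [fb]. *)
case: b / Eab gb ng gL => gb ng gL /= [d [q Eq]].
have /eq_pquot_poly Eg : exists q, g = translate f d + a *: q by exists q.
have Ef : (fb : nat -> pquot a) = fun i => pquot_pi a f`_i by apply/funext => i; rewrite -fL.
have Egb : (gb : nat -> pquot a) = fun i => pquot_pi a g`_i by apply/funext => i; rewrite -gL.
move: nf ng; rewrite Ef Egb => nf ng.
have [top eq] := normal_form_unique natU (@sysS2 a) Eg nf ng.
split; first by constructor; rewrite Ef Egb.
move=> reg; congr Datum2; apply/fsfunP => i; rewrite Ef Egb.
exact: eq reg i.
Qed.


End Parametrization.

(** * Normal forms over a field *)

Section FieldNormalForm.
Variable k : fieldType.
Hypothesis natU : forall n, exists u : k, u * n.+1%:R = 1.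

Lemma lead_index_size (p : {poly k}) n :
  lead_index (fun i => idfun p`_i) n <-> size p = n.+1.
Proof.
split=> [[/= pn0 pgt] | szp].
  apply/eqP; rewrite eqn_leq; apply/andP; split; first by apply/leq_sizeP => i /pgt.
  by rewrite ltnNge; apply/negP => le_pn; apply: pn0; rewrite nth_default.
split=> [|i lti] /=; last by rewrite nth_default ?szp.
apply/eqP; suff: lead_coef p != 0 by rewrite lead_coefE szp.
by rewrite lead_coef_eq0 -size_poly_eq0 szp.
Qed.

(** Modulo [0] every element is its own representative; modulo a nonzero element of a field the
    quotient is trivial and [0] represents it. *)
Definition zero_system (a s : k) : Prop := a = 0 \/ s = 0.

Lemma is_system_zero_system a : is_system a (zero_system a).
Proof.
move=> y; have [x <-] := pquot_pi_surj y; have [-> | a0] := eqVneq a 0.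
  exists x; split=> [|x' [_ /pquot_piP[c]]]; first by split; [left|].
  by rewrite mulr0 => /eqP; rewrite subr_eq0 => /eqP.
exists 0; split=> [|x' [[a_eq0 | -> //] _]]; last by rewrite a_eq0 eqxx in a0.
by split; [right | apply/pquot_piP; exists (- x / a); rewrite divfK // sub0r].
Qed.

Lemma subleading_zero_system (p : {poly k}) :
  subleading_in zero_system (fun i => idfun p`_i) <->
  forall n, size p = n.+2 -> p`_n = 0.
Proof.
split=> [nf n /lead_index_size lead | nf n lead].
  by case: (nf n lead) => //; case: lead.
by right; apply: nf; apply/lead_index_size.
Qed.

Lemma translate_eq0 (p : {poly k}) c : (translate p c == 0) = (p == 0).
Proof.
apply/eqP/eqP => [E0 | ->]; last by rewrite /translate comp_poly0.
by rewrite -[p]translate0 -(subrr c) translateD E0 /translate comp_poly0.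
Qed.

Lemma field_normal_form_unique (F : polymap k) : BAs2 F ->
  exists! G : polymap k, field_normal_form G /\ conj_BAs2 F G.
Proof.
move=> [f [a ->]]; have [-> | a0] := eqVneq a 0; last first.
  exists (tri 0 a); split=> [|G [nfG /(conj_triP natU)[c [q EG]]]].
    split; first by right; exists a.
    (* As [a] is invertible, all of [f] is a multiple of [a] and can be removed. *)
    apply/(conj_triP natU); exists 0, (- (a^-1 *: f)).
    by rewrite translate0 scalerN scalerA divff // scale1r subrr.
  case: nfG EG => [[g _ ->] | [lam ->]] /tri_inj[_ Ea]; last by rewrite Ea.
  by rewrite -Ea eqxx in a0.
have conj0 G : conj_BAs2 (tri f 0) G <-> exists c, G = tri (translate f c) 0.
  rewrite (conj_triP natU); split=> [[c [q ->]] | [c ->]].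
    by exists c; rewrite scale0r addr0.
  by exists c, 0; rewrite scaler0 addr0.
(* The identity map is a normal form of the second kind, with [lam = 0], since the first kind asks
   for a nonzero polynomial. *)
have [f0 | f0] := eqVneq f 0.
  have tf0 c : translate f c = 0 by apply/eqP; rewrite translate_eq0 f0.
  exists (tri 0 0); split=> [|G [_ /conj0[c ->]]]; last by rewrite tf0.
  by split; [right; exists 0 | apply/conj0; exists 0; rewrite tf0].
have [|c nf] := normal_form_exists (phi := idfun) natU is_system_zero_system f.
  by move=> y; exists y.
exists (tri (translate f c) 0); split=> [|G [nfG /conj0[d EG]]].
  split; last by apply/conj0; exists c.
  left; exists (translate f c) => //; split; first by rewrite translate_eq0.
  exact/subleading_zero_system.
case: nfG EG => [[g [_ nfg] ->] | [lam ->]] /tri_inj[Eg _]; last first.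
  by move/esym/eqP: Eg; rewrite translate_eq0 (negPf f0).
(* Both normal forms are translates of [f], hence of each other, by the difference of the two
   shifts. *)
have Egi i : idfun g`_i = idfun (translate (translate f c) (d - c))`_i.
  by rewrite -translateD addrC subrK Eg.
have /subleading_zero_system nfg' := nfg.
have [_ eq] := normal_form_unique natU is_system_zero_system Egi nf nfg'.
congr tri; apply/polyP; apply: eq => n [fn0 _]; exact/mulfI/eqP.
Qed.

End FieldNormalForm.

(** The form in which the inclusion of the rationals enters: the inverse is the image of a rational
    one. *)
Lemma rat_nat_inv (R : nzRingType) (iota : {rmorphism rat -> R}) n :
  exists u : R, u * n.+1%:R = 1.
Proof.
exists (iota n.+1%:R^-1); rewrite -(rmorph_nat iota) -rmorphM mulVf ?rmorph1 //.
by rewrite Num.Theory.pnatr_eq0.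
Qed.

Theorem theorem2p11 :
  (forall (R : idomainType) (iota : {rmorphism rat -> R})
      (S1 : R -> R -> Prop)
      (S2 : forall f2 : R, pquot f2 -> pquot f2 -> Prop),
    (forall a : R, is_system a (S1 a)) ->
    (forall (f2 : R) (ab : pquot f2), is_system ab (S2 f2 ab)) ->
    [/\ (forall d : datum R, admissible S1 S2 d ->
           exists2 E : polymap R, BAs2 E &
             forall F : polymap R, in_class d F <-> conj_BAs2 E F),
        (forall F : polymap R, BAs2 F ->
           exists2 d : datum R, admissible S1 S2 d & in_class d F) &
        (forall (d d' : datum R) (F : polymap R),
           admissible S1 S2 d -> admissible S1 S2 d' ->
           in_class d F -> in_class d' F ->
           same_leading_data d d' /\ (regular_lead d -> d = d'))])
  /\
  (forall (k : fieldType) (iota : {rmorphism rat -> k}) (F : polymap k),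
    BAs2 F ->
    exists! G : polymap k, field_normal_form G /\ conj_BAs2 F G).
Proof.
split=> [R iota S1 S2 sysS1 sysS2 | k iota F].
  have natU := rat_nat_inv iota.
  split; [exact: in_class_conj | exact: in_class_exists | exact: in_class_unique].
by move=> FB; apply: field_normal_form_unique => // n; exact: rat_nat_inv iota n.
Qed.
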